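(* Let $R$ be a commutative ring, $M$ an $R$-module and $T$ a non-empty subset of $\mathrm{Spec}(M)$. Suppose that $\bar M$ is an Artinian module such that for every minimal submodule $\bar N$ of $\bar M$, $N$ is a vertex of $G(\tau_T)$. Then $\omega(G(\tau_T))=\chi(G(\tau_T))$.
   Context: Rings are commutative with non-zero identity and modules are unital. $N<M$ means $N$ is a proper submodule of $M$. $(N:M)=\{r\in R: rM\subseteq N\}$. A prime submodule of $M$ is a submodule $P\neq M$ such that $re\in P$ ($r\in R$, $e\in M$) implies $r\in(P:M)$ or $e\in P$. $\mathrm{Spec}(M)$ is the set of prime submodules of $M$, and $V(N)=\{P\in\mathrm{Spec}(M): (P:M)\supseteq (N:M)\}$ for a submodule $N$ of $M$. $G(\tau_T)$ is the undirected graph with vertex set $\{N<M : \text{there exists } K<M \text{ with } V(N)\cup V(K)=T \text{ and } V(N),V(K)\neq T\}$, where distinct vertices $N,L$ are adjacent if and only if $V(N)\cup V(L)=T$. $Q:=(\bigcap_{P\in T}P:M)M$, $\bar M:=M/Q$, and $\bar N:=N/Q$ for a submodule $N$ of $M$ containing $Q$. $\omega(G)$ is the supremum of the sizes of cliques (complete subgraphs) of $G$ and $\chi(G)$ is the chromatic number of $G$; both are regarded as elements of $\mathbb N\cup\{\infty\}$. A minimal submodule is a minimal non-zero submodule. *)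

(* Defs.v *)
From HB Require Import structures.
From mathcomp Require Import all_boot all_order all_algebra.
From mathcomp Require Import generic_quotient.
From mathcomp Require Import boolp classical_sets functions cardinality.

Set Implicit Arguments.
Unset Strict Implicit.
Unset Printing Implicit Defensive.

Import Order.TTheory GRing.Theory.

Local Open Scope classical_set_scope.
Local Open Scope ring_scope.

(* Submodules of [M] are the bundled closed predicates [submodClosed M].  Their
   carriers are Boolean, but under the classical axioms of [boolp] every
   [Prop]-valued predicate is of this form, so all submodules are covered. *)

Section Submodules.
Variables (R : comNzRingType) (M : lmodType R).
Implicit Types (N K P : submodClosed M) (T : set (submodClosed M)).

Definition proper_submod N : Prop := exists x : M, x \notin N.

Definition nonzero_submod N : Prop := exists2 x : M, x \in N & x != 0.

Definition minimal_submod N : Prop :=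
  nonzero_submod N /\
  forall K, nonzero_submod K -> {subset K <= N} -> {subset N <= K}.

(* [colon N] is the ideal (N : M). *)
Definition colon N : set R := [set r | forall e : M, r *: e \in N].

Definition prime_submod P : Prop :=
  proper_submod P /\
  forall (r : R) (e : M), r *: e \in P -> colon P r \/ e \in P.

Definition Spec : set (submodClosed M) := [set P | prime_submod P].

Definition variety N : set (submodClosed M) :=
  [set P | Spec P /\ colon N `<=` colon P].

(* [idealM I] is the submodule I M generated by the products r *: e with r in
   the ideal I, described as the intersection of the submodules containing
   these products. *)
Definition idealM (I : set R) : {pred M} :=
  [pred x : M | `[< forall N : submodClosed M,
                      (forall r e, I r -> r *: e \in N) -> x \in N >] ].

Lemma idealM_closed (I : set R) : submod_closed (idealM I).
Proof.
split; first by apply/asboolP => N _; exact: rpred0.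
move=> a x y /asboolP xI /asboolP yI; apply/asboolP => N IN.
by apply: rpredD; [apply: rpredZ; exact: xI | exact: yI].
Qed.

HB.instance Definition _ (I : set R) :=
  GRing.isSubmodClosed.Build R M (idealM I) (idealM_closed I).

Definition interT T : {pred M} :=
  [pred x : M | `[< forall P, T P -> x \in P >] ].

Lemma interT_closed T : submod_closed (interT T).
Proof.
split; first by apply/asboolP => P _; exact: rpred0.
move=> a x y /asboolP xT /asboolP yT; apply/asboolP => P TP.
by apply: rpredD; [apply: rpredZ; exact: xT | exact: yT].
Qed.

HB.instance Definition _ T :=
  GRing.isSubmodClosed.Build R M (interT T) (interT_closed T).

(* The submodule Q = (\bigcap_(P in T) P : M) M. *)
Definition Qmod T : submodClosed M := idealM (colon (interT T)).

(* Descending chain condition on submodules. *)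
Definition artinian : Prop :=
  forall f : nat -> submodClosed M,
    (forall n, {subset f n.+1 <= f n}) ->
    exists n, forall m, (n <= m)%N -> f m =i f n.

End Submodules.

Arguments Spec {R} M.
Arguments artinian {R} M.

(* The quotient module M / N: the Z-module quotient of [ring_quotient],
   equipped with the induced scalar multiplication. *)
Section QuotientModule.
Variables (R : comNzRingType) (M : lmodType R) (N : submodClosed M).
Local Open Scope quotient_scope.

Definition submod_zmod : zmodClosed M :=
  HB.pack (N : {pred M})
    (GRing.isZmodClosed.Build M (N : {pred M})
      (GRing.submod_closedB (submodClosedP N))).

Definition quotmod := Quotient.quot submod_zmod.

HB.instance Definition _ := GRing.Zmodule.on quotmod.
HB.instance Definition _ := EqQuotient.on quotmod.

Definition quotmod_scale (a : R) : quotmod -> quotmod :=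
  lift_op1 quotmod ( *:%R a).

Lemma pi_quotmod_scale (a : R) (x : M) :
  quotmod_scale a (\pi_quotmod x) = \pi_quotmod (a *: x).
Proof.
rewrite /quotmod_scale; unlock; apply/eqP; rewrite -Quotient.idealrBE.
rewrite -scalerBr; have : repr (\pi_quotmod x) - x \in submod_zmod.
  by rewrite Quotient.idealrBE reprK.
exact: rpredZ.
Qed.

Lemma pi_quotmodD (x y : M) :
  \pi_quotmod (x + y) = \pi_quotmod x + \pi_quotmod y.
Proof. exact: (raddfD (\pi_(Quotient.quot submod_zmod))). Qed.

Fact quotmod_scaleA a b v :
  quotmod_scale a (quotmod_scale b v) = quotmod_scale (a * b) v.
Proof. by rewrite -[v]reprK !pi_quotmod_scale scalerA. Qed.

Fact quotmod_scale1 : left_id 1 quotmod_scale.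
Proof. by move=> v; rewrite -[v]reprK pi_quotmod_scale scale1r. Qed.

Fact quotmod_scaleDr : right_distributive quotmod_scale +%R.
Proof.
move=> a u v; rewrite -[u]reprK -[v]reprK.
by rewrite -pi_quotmodD !pi_quotmod_scale -pi_quotmodD scalerDr.
Qed.

Fact quotmod_scaleDl v : {morph quotmod_scale^~ v : a b / a + b}.
Proof.
by move=> a b /=; rewrite -[v]reprK !pi_quotmod_scale -pi_quotmodD scalerDl.
Qed.

HB.instance Definition _ := GRing.Zmodule_isLmodule.Build R quotmod
  quotmod_scaleA quotmod_scale1 quotmod_scaleDr quotmod_scaleDl.

(* The image of K in M / N; it is K / N when K contains N. *)
Definition quotsub (K : submodClosed M) : {pred quotmod} :=
  [pred y : quotmod | `[< exists2 x : M, x \in K & y = \pi_quotmod x >] ].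

Lemma quotsub_closed (K : submodClosed M) : submod_closed (quotsub K).
Proof.
split.
  apply/asboolP; exists 0; first exact: rpred0.
  by rewrite (raddf0 (\pi_(Quotient.quot submod_zmod))).
move=> a _ _ /asboolP[x xK ->] /asboolP[y yK ->]; apply/asboolP.
exists (a *: x + y); first by apply: rpredD => //; exact: rpredZ.
by rewrite pi_quotmodD -pi_quotmod_scale.
Qed.

HB.instance Definition _ (K : submodClosed M) :=
  GRing.isSubmodClosed.Build R quotmod (quotsub K) (quotsub_closed K).

End QuotientModule.

Arguments quotsub {R M} N K _.

(* The extended naturals, with [None] standing for infinity. *)
Definition enat := option nat.

Definition enat_le (x y : enat) : Prop :=
  match x, y with
  | _, None => True
  | None, Some _ => False
  | Some m, Some n => (m <= n)%N
  end.

(* The least element of a set of naturals, infinity if the set is empty. *)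
Definition enat_min (A : set nat) : enat :=
  if pselect (A !=set0) then Some [get n | A n /\ lbound A n] else None.

(* The supremum of a set of extended naturals: its least finite upper bound,
   or infinity if there is none. *)
Definition enat_sup (A : set enat) : enat :=
  enat_min [set n | forall x, A x -> enat_le x (Some n)].

(* The cardinality of a set, infinity if the set is infinite. *)
Definition set_size (U : Type) (A : set U) : enat :=
  enat_min [set n | (A #= `I_n)%card].

(* Undirected loopless graphs, possibly infinite. *)
Record sgraph := SGraph {
  vertex : Type;
  adj : vertex -> vertex -> Prop;
  adj_sym : forall x y, adj x y -> adj y x;
  adj_irr : forall x, ~ adj x x
}.

Definition is_clique (G : sgraph) (A : set (vertex G)) : Prop :=
  forall x y, A x -> A y -> x <> y -> adj x y.

Definition clique_number (G : sgraph) : enat :=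
  enat_sup [set set_size A | A in @is_clique G].

Definition colorable (G : sgraph) (n : nat) : Prop :=
  exists f : vertex G -> 'I_n, forall x y, adj x y -> f x <> f y.

Definition chromatic_number (G : sgraph) : enat := enat_min (colorable G).

Section ZariskiGraph.
Variables (R : comNzRingType) (M : lmodType R) (T : set (submodClosed M)).

Definition is_vertex (N : submodClosed M) : Prop :=
  proper_submod N /\
  exists K : submodClosed M,
    [/\ proper_submod K, variety N `|` variety K = T,
        variety N <> T & variety K <> T].

(* Distinct vertices are distinct submodules: the structures in
   [submodClosed M] consist of a carrier and proofs, so by the axioms of
   [boolp] they are equal as soon as their carriers agree. *)
Definition zvertex := {N : submodClosed M | is_vertex N}.

Definition zadj (N L : zvertex) : Prop :=
  N <> L /\ variety (sval N) `|` variety (sval L) = T.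

Lemma zadj_sym N L : zadj N L -> zadj L N.
Proof. by case=> NL VT; split; [move=> LN; exact: NL | rewrite setUC]. Qed.

Lemma zadj_irr N : ~ zadj N N.
Proof. by case. Qed.

Definition zgraph : sgraph := SGraph zadj_sym zadj_irr.

End ZariskiGraph.

(* Main.v *)
Require Import Defs.
From HB Require Import structures.
From mathcomp Require Import all_boot all_order all_algebra.
From mathcomp Require Import boolp classical_sets functions cardinality.

Set Implicit Arguments.
Unset Strict Implicit.
Unset Printing Implicit Defensive.

Import Order.TTheory GRing.Theory.

Local Open Scope classical_set_scope.
Local Open Scope ring_scope.

(* A vertex N exists only if T is closed, and then T is the set of all primes
   P with (P : M) containing I, the intersection of the ideals (P : M) for P in
   T.  The descending chain condition on the submodules above Q makes these
   ideals maximal, hence pairwise incomparable, and leaves only finitely many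
   of them, p_1, ..., p_n.  A vertex N misses some p_i, in that (N : M) is not
   contained in p_i, and adjacent vertices miss disjoint sets of ideals, so
   N |-> i is a proper n-coloring.  Conversely, the intersections N_i of the
   P in T with (P : M) <> p_i miss p_i only, so they form a clique of size n. *)

(** * Minima in the extended naturals *)

Lemma enat_minE (A : set nat) (n : nat) :
  A n -> lbound A n -> enat_min A = Some n.
Proof.
move=> An lAn; rewrite /enat_min; case: pselect => [A0|[]]; last by exists n.
congr Some; apply: get_unique => // m [Am lAm].
by apply: le_anti; rewrite lAm// lAn.
Qed.

Lemma set_sizeE (U : Type) (A : set U) (n : nat) :
  (A #= `I_n)%card -> set_size A = Some n.
Proof.
move=> An; apply: enat_minE => // m /= Am.
by have /card_eq_II-> : (`I_n #= `I_m)%card by rewrite -(card_eql An).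
Qed.

(** * Cliques against colorings in an arbitrary graph *)

Section Coloring.
Variable G : sgraph.

Lemma clique_card_le (n : nat) (A : set (vertex G)) :
  colorable G n -> is_clique A -> (A #<= `I_n)%card.
Proof.
move=> [f fP] cA; rewrite (card_le_eqr card_II).
rewrite -(card_le_eql (@inj_card_eq _ _ A f _)) ?subset_card_le//.
move=> x y /set_mem Ax /set_mem Ay fxy; apply: contrapT => xy.
exact: (fP x y (cA x y Ax Ay xy)).
Qed.

(** Both numbers are n: a coloring is injective on the clique [A], so it needs n colors, and the
    n-coloring is injective on every other clique. *)
Lemma clique_chromatic_number (n : nat) (A : set (vertex G)) :
  is_clique A -> (A #= `I_n)%card -> colorable G n ->
  clique_number G = chromatic_number G.
Proof.
move=> cA An Gn; rewrite /clique_number /enat_sup (@enat_minE _ n).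
- symmetry; apply: enat_minE => // m Gm; rewrite leEnat -card_le_II.
  by rewrite -(card_le_eql An); exact: clique_card_le.
- move=> _ [B cB <-]; have Bn := @clique_card_le _ _ Gn cB.
  have /finite_setP[m Bm] := card_le_finite Bn (finite_II n).
  by rewrite (set_sizeE Bm)/= -card_le_II -(card_le_eql Bm).
move=> m /(_ (Some n)) /= mP; rewrite leEnat; apply: mP.
by exists A => //; exact: set_sizeE.
Qed.

(** The finite set [X] serves both as the set of colors and as the index set of a clique; [k] is
    injective on [X] because no vertex is adjacent to itself. *)
Lemma colored_clique (U : Type) (X : set U) (c : vertex G -> U)
    (k : U -> vertex G) :
  finite_set X -> (forall v, X (c v)) ->
  (forall v w, adj v w -> c v <> c w) ->
  (forall p q, X p -> X q -> p <> q -> adj (k p) (k q)) ->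
  clique_number G = chromatic_number G.
Proof.
move=> /finite_setP[n Xn] Xc cP kP.
have kX : (k @` X #= X)%card.
  apply: inj_card_eq => p q /set_mem Xp /set_mem Xq kpq.
  apply: contrapT => /(kP p q Xp Xq); rewrite kpq; exact: adj_irr.
apply: (@clique_chromatic_number n (k @` X)).
- by move=> _ _ [p Xp <-] [q Xq <-] kpq; apply: kP => // pq; rewrite pq in kpq.
- exact: card_eq_trans kX Xn.
have /card_set_bijP[e [eX einj _]] := Xn.
exists (fun v => Ordinal (eX _ (Xc v))) => v w vw /(congr1 val)/= evw.
by apply: (cP v w vw); apply: einj => //; rewrite inE.
Qed.

End Coloring.

(** * The ideals (N : M) and descending chains above a submodule *)

Section Colon.
Variables (R : comNzRingType) (M : lmodType R).
Implicit Types (N K P L : submodClosed M) (T : set (submodClosed M)).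

Lemma colonM N (r s : R) : colon N r -> colon N (r * s).
Proof. by move=> Nr e; rewrite -scalerA. Qed.

Lemma colon1 N : proper_submod N -> ~ colon N 1.
Proof. by move=> [x /negP Nx] /(_ x); rewrite scale1r. Qed.

Lemma colon_prime P (r s : R) :
  prime_submod P -> colon P (r * s) -> colon P r \/ colon P s.
Proof.
move=> [_ Pp] Prs; have [|nPr] := pselect (colon P r); first by left.
right=> e; case: (Pp r (s *: e)) => //.
by rewrite scalerA.
Qed.

Lemma colon_interT T (r : R) :
  colon (interT T) r <-> (forall P, T P -> colon P r).
Proof.
split=> [Tr P TP e|Tr e]; first by have /asboolP := Tr e; exact.
by apply/asboolP => P TP; exact: Tr.
Qed.

Lemma Qmod_sub T P : T P -> {subset Qmod T <= P}.
Proof.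
move=> TP x /asboolP; apply=> r e Tr.
by have /colon_interT/(_ P TP) := Tr.
Qed.

(** Choose in each member of [X] an element outside the prime ideal (P : M); the product of these
    elements is the required [r]. *)
Lemma colon_prime_avoid P (X : set (set R)) :
  prime_submod P -> finite_set X ->
  (forall I r s, X I -> I r -> I (r * s)) ->
  (forall I, X I -> ~ I `<=` colon P) ->
  exists2 r, ~ colon P r & forall I, X I -> I r.
Proof.
move=> Pp /finite_seqP[s ->]; elim: s => [|J s IHs] XM XP.
  by exists 1 => //; exact/colon1/Pp.1.
case: IHs => [I r t Is|I Is|r Pr rs].
- by apply: XM; rewrite /= inE Is orbT.
- by apply: XP; rewrite /= inE Is orbT.
have /nonsubset[t [Jt Pt]] : ~ J `<=` colon P by apply: XP; rewrite /= mem_head.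
exists (t * r) => [/(colon_prime Pp)[]//|I /=].
rewrite inE => /predU1P[->|Is]; first by apply: XM; rewrite //= mem_head.
by rewrite mulrC; apply: XM (rs I Is); rewrite /= inE Is orbT.
Qed.

(** The submodule N + R u. *)
Definition add_cyclic N (u : M) : {pred M} :=
  [pred x | `[< exists a : R, x - a *: u \in N >] ].

Lemma add_cyclic_closed N u : submod_closed (add_cyclic N u).
Proof.
split; first by apply/asboolP; exists 0; rewrite scale0r subr0 rpred0.
move=> b x y /asboolP[a1 xN] /asboolP[a2 yN]; apply/asboolP.
exists (b * a1 + a2); rewrite scalerDl -scalerA opprD addrACA -scalerBr.
by apply: rpredD => //; exact: rpredZ.
Qed.

HB.instance Definition _ N u :=
  GRing.isSubmodClosed.Build R M (add_cyclic N u) (add_cyclic_closed N u).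

Lemma quotmod_pi_eq N (x y : M) :
  (\pi_(quotmod N) x = \pi_(quotmod N) y)%qT -> x - y \in N.
Proof. by move=> /eqP; rewrite -Quotient.idealrBE. Qed.

(** A submodule containing [N] is determined by its image in M / N, so the chain of images can be
    used. *)
Lemma artinian_above N (f : nat -> submodClosed M) :
  artinian (quotmod N) -> (forall n, {subset N <= f n}) ->
  (forall n, {subset f n.+1 <= f n}) ->
  exists n, {subset f n <= f n.+1}.
Proof.
move=> artN Nf fS; case: (artN (fun n => quotsub N (f n))) => [n y|n nP].
  by move=> /asboolP[x xf ->]; apply/asboolP; exists x => //; exact: fS.
exists n => x xf; have : (\pi_(quotmod N) x)%qT \in quotsub N (f n).
  by apply/asboolP; exists x.
rewrite -(nP n.+1)// => /asboolP[y yf /quotmod_pi_eq xyN].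
by rewrite -[x](subrK y) rpredD// Nf.
Qed.

End Colon.

(** * The ideals (P : M) for P in T under the chain condition *)

Section ArtinianPrimes.
Variables (R : comNzRingType) (M : lmodType R) (T : set (submodClosed M)).
Implicit Types (N K P L : submodClosed M).
Hypothesis TSpec : T `<=` Spec M.
Hypothesis artT : artinian (quotmod (Qmod T)).

Lemma colon_maximal P L :
  T P -> T L -> colon P `<=` colon L -> colon P = colon L.
Proof.
move=> TP TL PL; apply/seteqP; split=> // r Lr; apply: contrapT => nPr.
have [[e0 e0P] Pp] := TSpec TP.
(* The chain P + R r^n e0 stabilizes, so r^n (1 - a r) e0 is in P for some a
   and n, which puts 1 - a r in (P : M), hence 1 in (L : M). *)
pose f n : submodClosed M := add_cyclic P (r ^+ n *: e0).
have [n x xP|n x /asboolP[a xP]|n fn] := @artinian_above _ _ _ f artT.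
- by apply/asboolP; exists 0; rewrite scale0r subr0; exact: (Qmod_sub TP).
- apply/asboolP; exists (a * r).
  by rewrite -scalerA [r *: _]scalerA -exprS.
have : r ^+ n *: e0 \in f n.
  by apply/asboolP; exists 1; rewrite scale1r subrr rpred0.
move=> /fn/asboolP[a].
rewrite scalerA -scalerBl exprSr mulrCA -{1}[r ^+ n]mulr1 -mulrBr -scalerA.
have nPrn : ~ colon P (r ^+ n).
  elim: n {fn} => [|n IHn]; first exact/colon1/(TSpec TP).1.
  by rewrite exprS => /(colon_prime (TSpec TP))[].
move=> /Pp[//|/Pp[/PL L1|]]; last exact/negP.
apply: (colon1 (TSpec TL).1) => e.
rewrite -[1](subrK (a * r)) scalerDl rpredD//.
by rewrite mulrC; exact: colonM.
Qed.

(** Given infinitely many such ideals, take primes [h n] with distinct ideals [g n]. The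
    intersections of [h 0], ..., [h n.-1] stabilize, so one of them lies in [h n]. But the [g i]
    with i < n are not contained in [g n], so some [r] lies in all of them and not in [g n], a
    contradiction. *)
Lemma finite_colons : finite_set (@colon R M @` T).
Proof.
apply: contrapT => /infiniteP/pcard_leP[g].
have gT n : exists P, T P /\ colon P = g n.
  have [P TP <-] := @funS _ _ _ _ g n I.
  by exists P.
have [h hP] := choice gT.
pose f n : submodClosed M := interT (h @` `I_n).
have [n x xQ|n x /asboolP xh|n fn] := @artinian_above _ _ _ f artT.
- by apply/asboolP => _ [i _ <-]; exact: (Qmod_sub (hP i).1).
- apply/asboolP => _ [i ltin <-]; apply: xh; exists i => //=.
  exact: ltnW.
have hn := TSpec (hP n).1.
case: (@colon_prime_avoid R M (h n) (g @` `I_n) hn) => [|||r].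
- exact/finite_image/finite_II.
- by move=> J r s [i _ <-]; rewrite -(hP i).2; exact: colonM.
- move=> J [i /= ltin <-]; rewrite -(hP i).2.
  move=> /(colon_maximal (hP i).1 (hP n).1); rewrite (hP i).2 (hP n).2.
  by move=> /inj; rewrite !inE => /(_ I I) iEn; rewrite iEn ltnn in ltin.
move=> nr rP; apply: nr => e.
have /fn/asboolP : r *: e \in f n.
  apply/asboolP => _ [i ltin <-].
  have : g i r by apply: rP; exists i.
  by rewrite -(hP i).2; exact.
by apply; exists n => /=.
Qed.

(** * Closedness of T, the clique and the coloring *)

Section Vertex.
Variable v0 : zvertex T.

(** T is V(N) together with V(K), so a product of elements of (N : M) and (K : M) lies in (L : M)
    for every L in T. *)
Lemma colon_interT_mem P : Spec M P -> colon (interT T) `<=` colon P -> T P.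
Proof.
case: v0 => N [_ [K [_ NKT _ _]]] SP IP; rewrite -NKT.
apply: contrapT => /not_orP[nNP nKP].
have /nonsubset[r [Nr nPr]] : ~ colon N `<=` colon P.
  by move=> NP; apply: nNP.
have /nonsubset[s [Ks nPs]] : ~ colon K `<=` colon P.
  by move=> KP; apply: nKP.
have : colon P (r * s).
  apply: IP; apply/colon_interT => L; rewrite -NKT => -[[_ NL]|[_ KL]].
    exact/colonM/NL.
  by rewrite mulrC; exact/colonM/KL.
by move=> /(colon_prime SP)[].
Qed.

Lemma vertex_misses N : is_vertex T N ->
  exists2 P, T P & ~ colon N `<=` colon P.
Proof.
move=> [_ [K [_ NKT NT _]]]; apply: contrapT => nP; apply: NT.
apply/seteqP; split=> [P NP|P TP]; first by rewrite -NKT; left.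
split; first exact: TSpec.
by apply: contrapT => NP; apply: nP; exists P.
Qed.

(** If all ideals (L : M) were equal, a non-empty variety inside T would be all of T, so V(N) or
    V(K) would be T. *)
Lemma colon_other (p : set R) : exists2 L, T L & colon L <> p.
Proof.
case: v0 => N [_ [K [_ NKT NT KT]]].
apply: contrapT => np.
have pE L : T L -> colon L = p.
  by move=> TL; apply: contrapT => Lp; apply: np; exists L.
have all S : variety S `<=` T -> variety S !=set0 -> variety S = T.
  move=> ST [L SL]; apply/seteqP; split=> // L' TL'; split; first exact: TSpec.
  by rewrite (pE _ TL') -(pE _ (ST _ SL)); exact: SL.2.
have [[L NL]|nN] := pselect (variety N !=set0).
  by apply: NT; apply: all; [rewrite -NKT => ? ?; left|exists L].
apply: KT; rewrite -NKT; apply/seteqP; split=> L; first by right.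
by case=> // NL; case: nN; exists L.
Qed.

Let X := @colon R M @` T.

Let N_ (p : set R) : submodClosed M := interT (T `&` [set P | colon P <> p]).

Lemma variety_omit (p : set R) : X p ->
  variety (N_ p) = T `&` [set P | colon P <> p].
Proof.
move=> [P0 TP0 <-{p}]; apply/seteqP; split=> P; last first.
  move=> [TP Pp]; split; first exact: TSpec.
  by move=> r /colon_interT; apply.
move=> [SP NP]; have TP : T P.
  apply: colon_interT_mem => // r /colon_interT rT; apply: NP.
  by apply/colon_interT => L [TL _]; exact: rT.
split=> // PP0.
(* By incomparability, some [r] outside (P : M) lies in all the other ideals, hence in the colon of
   [N_ p]. *)
have [|||r nPr rX] := @colon_prime_avoid R M P (X `\ colon P) SP.
- exact/finite_setD/finite_colons.
- by move=> J r s [[L TL <-] _]; exact: colonM.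
- by move=> J [[L TL <-] LP] /(colon_maximal TL TP).
apply: nPr; apply: NP; apply/colon_interT => L [TL LP0].
by apply: rX; split; [exists L|rewrite PP0].
Qed.

Lemma variety_omitU (p q : set R) : X p -> X q -> p <> q ->
  variety (N_ p) `|` variety (N_ q) = T.
Proof.
move=> Xp Xq pq; rewrite !variety_omit//; apply/seteqP; split=> P.
  by case=> -[].
move=> TP; have [Pp|Pp] := pselect (colon P = p); last by left.
by right; split=> //; rewrite /= Pp.
Qed.

Lemma variety_omit_neq (p : set R) : X p -> variety (N_ p) <> T.
Proof.
move=> Xp; rewrite variety_omit// => /seteqP[_].
by case: Xp => P TP <- /(_ P TP)[].
Qed.

(** By [colon_other] the intersection is not the empty one, which would be M. *)
Lemma proper_omit (p : set R) : proper_submod (N_ p).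
Proof.
have [L TL Lp] := colon_other p; have [[x xL] _] := TSpec TL.
by exists x; apply: contra xL => /asboolP; apply.
Qed.

Lemma vertex_omit (p : set R) : X p -> is_vertex T (N_ p).
Proof.
move=> Xp; split; first exact: proper_omit.
have [L TL Lp] := colon_other p.
have XL : X (colon L) by exists L.
exists (N_ (colon L)); split.
- exact: proper_omit.
- by apply: variety_omitU => // pL; exact: Lp.
- exact: variety_omit_neq.
- exact: variety_omit_neq.
Qed.

Lemma clique_chromatic_nonempty :
  clique_number (zgraph T) = chromatic_number (zgraph T).
Proof.
have /choice[c cP] : forall v : zvertex T,
    exists p, X p /\ ~ colon (sval v) `<=` p.
  move=> [N vN]; have [P TP NP] := vertex_misses vN.
  by exists (colon P); split=> //; exists P.
(* Outside [X] the value [v0] is only a default. *)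
have /choice[k kP] : forall p, exists v : zvertex T, X p -> sval v = N_ p.
  move=> p; have [Xp|] := pselect (X p); last by exists v0.
  by exists (exist _ _ (vertex_omit Xp)).
apply: (@colored_clique (zgraph T) _ X c k).
- exact: finite_colons.
- by move=> v; have [] := cP v.
(* A prime P of T whose ideal is the common color would lie in neither variety, although their union
   is T. *)
- move=> v w [_ vwT] cvw; have [[P TP Pcv] cv] := cP v.
  have [_] := cP w; rewrite -cvw -Pcv => cw.
  rewrite -Pcv in cv; move: TP; rewrite -vwT.
  by case=> -[_].
move=> p q Xp Xq pq.
have kpq : variety (sval (k p)) `|` variety (sval (k q)) = T.
  by rewrite !kP//; exact: variety_omitU.
split=> // kE; move: kpq; rewrite kE setUid kP//.
exact: variety_omit_neq.
Qed.

End Vertex.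
End ArtinianPrimes.

Theorem theorem4p1 (R : comNzRingType) (M : lmodType R)
    (T : set (submodClosed M)) :
  T !=set0 ->
  T `<=` Spec M ->
  artinian (quotmod (Qmod T)) ->
  (forall N : submodClosed M, {subset Qmod T <= N} ->
     minimal_submod (quotsub (Qmod T) N) -> is_vertex T N) ->
  clique_number (zgraph T) = chromatic_number (zgraph T).
Proof.
move=> _ TSpec artT _.
have [[v0]|nv] := pselect (inhabited (zvertex T)).
  exact: clique_chromatic_nonempty TSpec artT v0.
(* Without vertices both numbers are 0, by the empty clique and the empty coloring. *)
apply: (@clique_chromatic_number (zgraph T) 0 set0) => //.
  by rewrite II0.
have nv' (v : zvertex T) : False by apply: nv; exists.
by exists (fun v => False_rect _ (nv' v)) => v; case: (nv' v).
Qed.
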